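(* Suppose $\kappa$ is a cardinal such that $\mathfrak{s}(\mathbb{R})\leq\kappa=\mathrm{cof}(\kappa^{\aleph_0},\subseteq)$. Then $\mathfrak{z}\leq\kappa$.
   Context: All spaces are infinite Hausdorff topological spaces. For infinite sets $U, A$, say $U$ splits $A$ if both $A\cap U$ and $A\setminus U$ are infinite. $\mathfrak{s}(\mathbb{R})$ is the smallest cardinality of a family $\mathcal{U}$ of open subsets of $\mathbb{R}$ (usual topology) such that every infinite $A\subseteq\mathbb{R}$ is split by some $U\in\mathcal{U}$. A space is non-sequential if it is not discrete and contains no non-trivial convergent sequence; $\mathfrak{z}$ is the smallest weight of a compact non-sequential space. $\mathrm{cof}(\kappa^{\aleph_0},\subseteq)$ is the smallest cardinality of a family $\mathcal{C}$ of countable subsets of $\kappa$ such that every countable subset of $\kappa$ is contained in some member of $\mathcal{C}$. *)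

(* Defs.v *)
From HB Require Import structures.
From mathcomp Require Import all_boot all_order all_algebra.
From mathcomp Require Import all_classical all_reals topology normedtype.
Set Implicit Arguments. Unset Strict Implicit. Unset Printing Implicit Defensive.
Import Order.TTheory GRing.Theory Num.Theory numFieldNormedType.Exports.
Local Open Scope classical_set_scope.
Local Open Scope card_scope.

Definition infinite_set {T} (A : set T) : Prop := ~ finite_set A.

Definition splits {T} (U A : set T) : Prop :=
  infinite_set (A `&` U) /\ infinite_set (A `\` U).

Definition splitting_open_family (R : realType) (F : set (set R)) : Prop :=
  (forall U, F U -> open U) /\
  (forall A : set R, infinite_set A -> exists2 U, F U & splits U A).

Definition cofinal_countable_family (K : Type) (C : set (set K)) : Prop :=
  (forall D, C D -> countable D) /\
  (forall A : set K, countable A -> exists2 D, C D & A `<=` D).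

Definition is_base (T : topologicalType) (B : set (set T)) : Prop :=
  (forall U, B U -> open U) /\
  (forall O : set T, open O -> forall x, O x -> exists2 U, B U & U x /\ U `<=` O).

Definition discrete_top (T : topologicalType) : Prop := forall A : set T, open A.

Definition has_nontrivial_convergent_seq (T : topologicalType) : Prop :=
  exists (u : nat -> T) (x : T), injective u /\ u @ \oo --> x.

Definition non_sequential (T : topologicalType) : Prop :=
  ~ discrete_top T /\ ~ has_nontrivial_convergent_seq T.

(* Main.v *)
(** Let [u] converge to [y] in the Cantor set, embedded in the line, and let an
    open set [U] split the range of [u]. Then [y] is not in [U], so if [U] is cut
    into clopen pieces numbered by integers, the terms of [u] in [U] meet
    infinitely many pieces. A second splitting, now of the set of these numbers
    viewed inside the line, divides [U] into two disjoint open sets that both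
    contain infinitely many terms. Hence kappa many pairs of disjoint open sets
    suffice against all sequences in the Cantor set.

    The space is a closed subset of [2^(K * L)], with [L] a copy of [omega_1]
    inside [kappa]. The coordinate [(k, l)] separates the two open sets of the
    [k]-th pair, placed in the Cantor set of those coordinates that belong to the
    [k]-th countable set and have level below [l]; solving the resulting
    constraints is a recursion on levels. A convergent sequence is separated by
    countably many coordinates, their levels are bounded in [omega_1], and so some
    coordinate [(k, l)] takes both values infinitely often along it. *)

Require Import Defs.
From HB Require Import structures.
From mathcomp Require Import all_boot all_order all_algebra.
From mathcomp Require Import all_classical all_reals topology normedtype.
From mathcomp Require Import wochoice lra.
Import Order.TTheory GRing.Theory Num.Theory.
Import numFieldNormedType.Exports.
Local Open Scope classical_set_scope.
Local Open Scope card_scope.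

(** * Infinite sets and injective codings in an infinite cardinal *)

Lemma infinite_inj (T : Type) (A : set T) : Defs.infinite_set A ->
  exists2 s : nat -> T, injective s & range s `<=` A.
Proof.
elim/Ppointed: T => T in A *; first by rewrite emptyE => /(_ (finite_set0 _)).
move=> /infiniteP/pcard_leP/unsquash f; exists f.
  by move=> m n; apply: inj; rewrite inE.
by move=> _ [n _ <-]; apply: funS.
Qed.

Lemma injective_range_infinite (T : Type) (s : nat -> T) :
  injective s -> Defs.infinite_set (range s).
Proof.
move=> sI; apply/infiniteP; rewrite (card_le_eqr (inj_card_eq _)) //.
by move=> m n _ _ /sI.
Qed.

(** By Zorn, take a maximal family [S] of injective sequences with disjoint ranges. By maximality
    these ranges miss only finitely many points, so the set is essentially [S * nat], which absorbs
    one more factor [nat]. *)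
Lemma infinite_mul_nat (K : pointedType) : Defs.infinite_set [set: K] ->
  exists f : K * nat -> K, injective f.
Proof.
move=> Kinf.
pose P (S : set (nat -> K)) := forall s t m n, S s -> S t ->
  s m = t n -> s = t /\ m = n.
have [F FP totF|S [PS maxS]] := @Zorn_bigcup _ P.
  move=> s t m n [A FA As] [B FB Bt].
  by have [AB|BA] := totF _ _ FA FB; [apply: (FP B)|apply: (FP A)] => //;
     [exact: AB|exact: BA].
pose Rg := [set k | exists s n, S s /\ s n = k].
have coRg : finite_set (~` Rg).
  apply: contrapT => /infinite_inj [t tI tR].
  apply: (maxS (t |` S)).
    split=> [s Ss|]; first by right.
    move=> /(_ t (or_introl erefl)) St.
    by apply: (tR (t 0%N)); [exists 0%N|exists t, 0%N].
  have tS s m n : S s -> s m = t n -> False.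
    by move=> Ss st; apply: (tR (t n)); [exists n|exists s, m].
  move=> s s' m n [->|Ss] [->|Ss'].
  - by move=> /tI.
  - by move=> /esym /(tS _ _ _ Ss').
  - by move=> /(tS _ _ _ Ss).
  - exact: PS.
have /infinite_setN0 [k0 [s0 [_ [Ss0 _]]]] : Defs.infinite_set Rg.
  move=> fR; apply: Kinf.
  by rewrite -(setUv Rg); rewrite finite_setU.
have /countable_injP [q qI] := finite_set_countable coRg.
have [c cI] : exists c : K -> (nat -> K) * nat,
    injective c /\ forall k, S (c k).1.
  (* Covered points go to even positions of their own sequence; the finitely many leftover points go
     to odd positions of [s0]. *)
  have /choice [c cP] : forall k, exists sn : (nat -> K) * nat, S sn.1 /\
      ((exists2 n, sn.1 n = k & sn.2 = n.*2) \/
       (~ Rg k /\ sn = (s0, (q k).*2.+1))).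
    move=> k; have [[s [n [Ss sn]]]|nR] := pselect (Rg k).
      by exists (s, n.*2); split=> //; left; exists n.
    by exists (s0, (q k).*2.+1); split=> //; right.
  exists c; split; last by move=> k; have [] := cP k.
  move=> k l ckl; have [_ +] := cP k; have [_ +] := cP l; rewrite -ckl.
  have par a b : a.*2 = b.*2.+1 -> False by move=> /(congr1 odd); rewrite /= !odd_double.
  move=> [[m lE lm]|[lR le]] [[n kE kn]|[kR ke]].
  - by rewrite -kE -lE; congr (_ _); apply: double_inj; rewrite -kn.
  - by case: (par m (q k)); rewrite -lm ke.
  - by case: (par n (q l)); rewrite -kn le.
  - have [qe] : (s0, (q k).*2.+1) = (s0, (q l).*2.+1) by rewrite -ke -le.
    by apply: qI (double_inj qe); exact: mem_set.
exists (fun km => (c km.1).1 (pickle ((c km.1).2, km.2))) => -[k m] [l n] /= /PS.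
move=> /(_ (cI.2 k) (cI.2 l)) [ckl] /(pcan_inj pickleK) [ckl2 ->].
by rewrite (cI.1 k l) // [c k]surjective_pairing ckl ckl2 -surjective_pairing.
Qed.

(* Any two points lie in a member of the family, so a pair is coded by such a
   member and two positions in an enumeration of it. *)
Lemma cofinal_countable_square {K : pointedType} {C : set (set K)} :
  Defs.infinite_set [set: K] -> cofinal_countable_family C ->
  C #<= [set: K] -> exists f : K * K -> K, injective f.
Proof.
move=> /infinite_mul_nat [m mI] [Ccount Ccof] /pcard_injP [j jI].
have /choice [e eP] : forall D : set K, exists e : K -> nat,
    C D -> {in D &, injective e}.
  move=> D; have [/Ccount /countable_injP[e eI]|] := pselect (C D).
    by exists e.
  by exists (fun=> 0%N).
have /choice [D DP] : forall ab : K * K, exists D, [/\ C D, D ab.1 & D ab.2].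
  move=> [a b]; have [|D CD abD] := Ccof [set a; b].
    exact/finite_set_countable/finite_set2.
  by exists D; split => //; apply: abD; [left|right].
exists (fun ab => m (m (j (D ab), e (D ab) ab.1), e (D ab) ab.2)).
move=> ab ab' /mI [/mI [/jI Dab]].
have [CD Da Db] := DP ab; have [CD' Da' Db'] := DP ab'.
move: Dab; rewrite !inE => /(_ CD CD') Dab; rewrite -Dab in Da' Db' *.
move=> /(eP _ CD); rewrite !inE => /(_ Da Da') a1.
move=> /(eP _ CD); rewrite !inE => /(_ Db Db') a2.
by rewrite [ab]surjective_pairing a1 a2 -surjective_pairing.
Qed.

(** The iterated pairing [code] alone is ambiguous, since its end marker [s 0] may itself be a pair;
    storing the length as [s (size t)] repairs this. *)
Lemma seq_inj (K : Type) (p : K * K -> K) :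
  Defs.infinite_set [set: K] -> injective p ->
  exists f : seq K -> K, injective f.
Proof.
move=> /infinite_inj [s sI _] pI.
pose code := foldr (fun k c => p (k, c)) (s 0%N).
exists (fun t => p (s (size t), code t)) => t t' /pI [/sI].
elim: t t' => [|k t IH] [|k' t'] //= [tt'] /pI [-> ct].
by rewrite (IH t').
Qed.

(** * Well-orders and a copy of the first uncountable ordinal *)

(** Antisymmetry comes from uniqueness of the minimum of [{x, y}], transitivity from a minimum of
    [{x, y, z}]. *)
Lemma exists_well_order (T : choiceType) : exists le : T -> T -> Prop,
  [/\ forall x y z, le x y -> le y z -> le x z,
    forall x y, le x y -> le y x -> x = y &
    forall A : set T, A !=set0 -> exists2 z, A z & forall y, A y -> le z y].
Proof.
have [R woR] := well_ordering_principle T.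
have min (A : set T) x : A x -> exists2 z, A z & forall y, A y -> R z y.
  move=> Ax; have [|z [[+ zmin] _]] := woR (mem A).
    by exists x; rewrite inE.
  by rewrite inE => Az; exists z => // y Ay; apply: zmin; rewrite inE.
have refl x : R x x by have [|z -> ] := min [set x] x; [|exact].
have anti x y : R x y -> R y x -> x = y.
  move=> Rxy Ryx; have [|z [_ zU]] := woR (mem [set x; y]).
    by exists x; rewrite inE; left.
  by rewrite -(zU x) ?(zU y)//; split=> [|w]; rewrite inE;
    [right| case=> -> | left | case=> ->].
exists (fun x y => R x y); split=> // [x y z Rxy Ryz|A [x]]; last exact: min.
have [|m mA mle] := min [set w | [\/ w = x, w = y | w = z]] x.
  exact: Or31.
have [Rmx Rmy Rmz] : [/\ R m x, R m y & R m z].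
  by split; apply: mle; [exact: Or31|exact: Or32|exact: Or33].
case: mA => ?; subst m => //.
  by rewrite (anti x y).
by rewrite (anti y z) // in Rxy.
Qed.

(* The points of a well-ordered uncountable set with countably many
   predecessors form a copy of the first uncountable ordinal. *)
Lemma uncountable_levels (K : choiceType) : ~ countable [set: K] ->
  exists (L : choiceType) (lt : L -> L -> Prop) (j : L -> K) (l0 : L),
    [/\ well_founded lt, injective j, forall l, ~ lt l l0 &
      forall s : nat -> L, exists l, forall n, lt (s n) l].
Proof.
move=> Kunc; have [le [trans anti min]] := exists_well_order K.
have refl x : le x x by have [|z -> ] := min [set x]; [exists x|exact].
have tot x y : ~ le x y -> le y x.
  by have [|z [->|->] zle nxy] := min [set x; y]; [exists x; left|
    case: nxy; apply: zle; right|apply: zle; left].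
pose ini x := [set y | le y x].
pose W := [pred x | `[< countable (ini x) >]].
pose L : choiceType := {x | W x}.
pose lt (l l' : L) := le (val l) (val l') /\ l <> l'.
have bound (s : nat -> L) : exists l, forall n, lt (s n) l.
  pose U := \bigcup_n ini (val (s n)).
  have Uc : countable U.
    apply: bigcup_countable => [|n _]; first exact: countableP.
    by have /asboolP := valP (s n).
  (* The least point outside the countable union [U] has all its predecessors in [U], hence is
     itself a level. *)
  have [|z zU zmin] := min (~` U).
    apply/set0P/eqP => U0; apply: Kunc; apply: sub_countable Uc.
    by apply: subset_card_le => y _; apply: contrapT => Uy; have : (~` U) y := Uy; rewrite U0.
  have zW : W z.
    apply/asboolP; have Uz : countable (z |` U).
      by rewrite -bigcup2E; apply: bigcup_countable => [|[|[|n]] _] //=;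
        exact: countable1.
    apply: sub_countable Uz; apply: subset_card_le => y yz.
    have [Uy|nUy] := pselect (U y); first by right.
    by left; apply: anti => //; exact: zmin.
  exists (exist _ z zW) => n; split=> /= [|sn].
    by apply: tot => zs; apply: zU; exists n.
  by apply: zU; exists n => //; rewrite /ini /= sn.
have [x0 _] : exists x : K, True.
  apply: contrapT => nK; apply: Kunc.
  have -> : [set: K] = set0 by apply/seteqP; split=> // y _; apply: nK; exists y.
  exact: countable0.
have [z0 _ z0min] := min setT (ex_intro _ x0 I).
have z0W : W z0.
  apply/asboolP; apply: sub_countable (countable1 z0); apply: subset_card_le.
  by move=> y yz; apply: anti => //; exact: z0min.
exists L, lt, val, (exist _ z0 z0W); split; last exact: bound.
- move=> l; apply: contrapT => nl.
  have [|z [m nm <-] mmin] := min [set val m | m in [set m : L | ~ Acc lt m]].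
    by exists (val l), l.
  apply: nm; constructor => k [km kNm]; apply: contrapT => nk; apply: kNm.
  by apply/val_inj/anti => //; apply: mmin; exists k.
- exact: val_inj.
- by move=> l [lz]; apply; apply/val_inj/anti => //; exact: z0min.
Qed.

(** * Cylinders of the Cantor set and its embedding in the line *)

Definition cylinder (y : nat -> bool) (m : nat) : set (nat -> bool) :=
  [set z | forall i, (i < m)%N -> z i = y i].

Lemma cylinder_sym y z m : cylinder y m z -> cylinder z m y.
Proof. by move=> yz i /yz. Qed.

Lemma cylinder_trans y z w m : cylinder y m z -> cylinder z m w ->
  cylinder y m w.
Proof. by move=> yz zw i im; rewrite zw // yz. Qed.

Lemma cylinderW y m n : (m <= n)%N -> cylinder y n `<=` cylinder y m.
Proof. by move=> mn z yz i im; apply: yz; exact: leq_trans mn. Qed.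

Section CantorEmbedding.
Local Open Scope ring_scope.
Variable R : realType.
Implicit Types (x y : nat -> bool) (n m : nat).

Let psum x n : R := \sum_(i < n) (x i)%:R * 3^-1 ^+ i.

Let psumS x n : psum x n.+1 = psum x n + (x n)%:R * 3^-1 ^+ n.
Proof. by rewrite /psum big_ord_recr. Qed.

Let pow_gt0 n : 0 < 3^-1 ^+ n :> R.
Proof. by rewrite exprn_gt0 // invr_gt0. Qed.

Let psum_tail x n k :
  psum x n <= psum x (n + k) <= psum x n + 3 / 2 * (3^-1 ^+ n - 3^-1 ^+ (n + k)).
Proof.
elim: k => [|k /andP[IH1 IH2]]; first by rewrite addn0 subrr mulr0 addr0 lexx.
rewrite addnS psumS exprS; have := pow_gt0 (n + k).
by case: (x (n + k)%N) => /= Hp; apply/andP; split; lra.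
Qed.

Let psum_le x n m : psum x m <= psum x n + 3 / 2 * 3^-1 ^+ n.
Proof.
have := pow_gt0 n; have := pow_gt0 m; have [nm|/ltnW mn] := leqP n m.
  by have := psum_tail x n (m - n); rewrite subnKC // => /andP[]; lra.
by have := psum_tail x m (n - m); rewrite subnKC // => /andP[]; lra.
Qed.

(** The sum of the series with terms [x i / 3 ^ i], as a supremum of its increasing partial sums. *)
Definition cantor_embedding x : R := sup (range (psum x)).

Let emb_bounds x n :
  psum x n <= cantor_embedding x <= psum x n + 3 / 2 * 3^-1 ^+ n.
Proof.
have ne : range (psum x) !=set0 by exists (psum x 0%N), 0%N.
apply/andP; split.
  apply: ub_le_sup; last by exists n.
  by exists (psum x 0 + 3 / 2 * 3^-1 ^+ 0) => _ [m _ <-]; exact: psum_le.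
by apply: ge_sup => // _ [m _ <-]; exact: psum_le.
Qed.

Let psum_cylinder x y n : cylinder x n y -> psum y n = psum x n.
Proof. by move=> xy; apply: eq_bigr => i _; rewrite xy. Qed.

(** The digits after position [n] contribute at most [3 / 2 * 3^-1 ^+ n.+1], half of what the digit
    at [n] contributes. *)
Let emb_lt x y n : cylinder x n y -> x n -> ~~ y n ->
  cantor_embedding y < cantor_embedding x.
Proof.
move=> /psum_cylinder pE xn /negbTE yn.
have /andP[+ _] := emb_bounds x n.+1; have /andP[_ +] := emb_bounds y n.+1.
rewrite !psumS xn yn pE exprS /=; have := pow_gt0 n; lra.
Qed.

Lemma cantor_embedding_inj : injective cantor_embedding.
Proof.
move=> x y gxy; apply: contrapT => /eqP; apply/negP; rewrite negbK.
apply/eqP/funext => i; elim/ltn_ind: i => n IH.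
have xy : cylinder x n y by move=> j /IH.
have yx := cylinder_sym _ _ _ xy.
case xn : (x n); case yn : (y n) => //; exfalso.
  by have := emb_lt _ _ _ xy xn (negbT yn); rewrite gxy ltxx.
by have := emb_lt _ _ _ yx yn (negbT xn); rewrite gxy ltxx.
Qed.

Lemma cantor_embedding_open (U : set R) x : open U ->
  U (cantor_embedding x) ->
  exists n, cylinder x n `<=` cantor_embedding @^-1` U.
Proof.
move=> Uo Ux; have /nbhs_ballP [e /= e0 eU] := open_nbhs_nbhs (conj Uo Ux).
have [n ne] : exists n, 3 / 2 * 3^-1 ^+ n < e.
  exists (Num.bound (3 / 2 / e)); set n := Num.bound _.
  have h : 3 / 2 / e < 2 ^+ n by apply: upper_nthrootP.
  have h3 : (2 : R) ^+ n <= 3 ^+ n by rewrite lerXn2r ?nnegrE //; lra.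
  rewrite exprVn ltr_pdivrMr ?exprn_gt0 // [e * _]mulrC -ltr_pdivrMr //.
  exact: lt_le_trans h h3.
exists n => y xy; apply: eU; rewrite /ball /=.
have := emb_bounds x n; have := emb_bounds y n.
rewrite (psum_cylinder _ _ _ xy) => /andP[a b] /andP[c d].
by rewrite ltr_norml; apply/andP; split; lra.
Qed.

End CantorEmbedding.

(* [G] is split into the clopen pieces where the least cylinder contained in
   [G] has a given length [m]. *)
Definition rank (G : set (nat -> bool)) (y : nat -> bool) (m : nat) : Prop :=
  cylinder y m `<=` G /\ forall k, (k < m)%N -> ~ cylinder y k `<=` G.

Lemma cylinder_eq y z m : cylinder y m z -> cylinder z m = cylinder y m.
Proof.
move=> yz; apply/seteqP; split=> w; first exact: cylinder_trans.
exact/cylinder_trans/cylinder_sym.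
Qed.

Lemma rank_cylinder G y z m : cylinder y m z -> rank G y m -> rank G z m.
Proof.
move=> yz [yG ymin]; split=> [|k km]; first by rewrite (cylinder_eq _ _ _ yz).
by rewrite (cylinder_eq _ _ _ (cylinderW _ _ _ (ltnW km) _ yz)); exact: ymin.
Qed.

Lemma rank_unique G y m k : rank G y m -> rank G y k -> m = k.
Proof.
move=> [mG mmin] [kG kmin]; apply/eqP; rewrite eqn_leq [(m <= k)%N]leqNgt [(k <= m)%N]leqNgt.
by apply/andP; split; apply/negP; [move=> /mmin/(_ kG)|move=> /kmin/(_ mG)].
Qed.

Lemma ex_rank G y n : cylinder y n `<=` G -> exists m, rank G y m.
Proof.
move=> nG; have exG : exists k, `[< cylinder y k `<=` G >].
  by exists n; apply/asboolP.
have [m /asboolP mG mmin] := ex_minnP exG.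
exists m; split=> // k km /asboolP /mmin; by rewrite leqNgt km.
Qed.

(** * Splitting convergent sequences of the Cantor set *)

Lemma infinite_natP (S : set nat) :
  Defs.infinite_set S <-> forall N, exists2 n, (N <= n)%N & S n.
Proof.
split=> [Sinf N|Sub].
  apply: contrapT => nS; apply: Sinf; apply: sub_finite_set (finite_II N).
  by move=> n Sn /=; rewrite ltnNge; apply/negP => Nn; apply: nS; exists n.
move=> /finite_seqP [s sE]; have [n + Sn] := Sub (\max_(i <- s) i).+1.
rewrite ltnNge => /negP; apply; apply: leq_bigmax_seq => //.
by have : [set` s] n by rewrite -sE.
Qed.

Lemma splits_range (T : Type) (s : nat -> T) (U : set T) : splits U (range s) ->
  Defs.infinite_set [set n | U (s n)] /\ Defs.infinite_set [set n | ~ U (s n)].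
Proof.
move=> [U1 U2]; split=> /(finite_image s) fin; [apply: U1|apply: U2];
  by apply: sub_finite_set fin => _ [[n _ <-] Un]; exists n.
Qed.

Definition rank_split (R : realType) (U V : set R) (y : nat -> bool) (b : bool) :=
  exists2 m, rank (cantor_embedding R @^-1` U) y m & `[< V m%:R%R >] = b.

(* Along a sequence converging to [y], with [U] splitting its image, [y] cannot
   lie in the open set [U], so the ranks of the terms in [U] are unbounded; a
   second member [V] splits the set of these ranks. *)
Lemma splitting_ranks (R : realType) (F : set (set R)) (u : nat -> nat -> bool)
    (y : nat -> bool) :
  splitting_open_family F -> injective u ->
  (forall m, exists N, forall n, (N <= n)%N -> cylinder y m (u n)) ->
  exists U V, [/\ F U, F V &
    forall b N, exists2 n, (N <= n)%N & rank_split R U V (u n) b].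
Proof.
move=> [Fopen Fsplit] uI uy.
have gI : injective (fun n => cantor_embedding R (u n)).
  by move=> m n /cantor_embedding_inj /uI.
have [U FU /splits_range [/infinite_natP inU /infinite_natP outU]] :=
  Fsplit _ (injective_range_infinite _ _ gI).
pose G := cantor_embedding R @^-1` U.
have nGy m : ~ cylinder y m `<=` G.
  by move=> ymG; have [N uN] := uy m; have [n /uN /ymG] := outU N.
pose M := [set m | exists n, rank G (u n) m].
(* A term in [cylinder y B] of rank below [B] would put a whole cylinder around [y] inside [G]. *)
have Munb N B : exists m, (B <= m)%N /\ exists2 n, (N <= n)%N & rank G (u n) m.
  have [N' uN] := uy B; have [n] := inU (maxn N N').
  rewrite geq_max => /andP[Nn /uN yun] Un.
  have [k /ex_rank [m rm]] := cantor_embedding_open _ _ _ (Fopen _ FU) Un.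
  exists m; split; last by exists n.
  rewrite leqNgt; apply/negP => mB; apply: (nGy m).
  by rewrite -(cylinder_eq _ _ _ (cylinderW _ _ _ (ltnW mB) _ yun)); exact: (proj1 rm).
have Minf : Defs.infinite_set M.
  by apply/infinite_natP => B; have [m [Bm [n _ rn]]] := Munb 0%N B; exists m => //; exists n.
have [t tI tM] := infinite_inj _ _ Minf.
have tRI : injective (fun n => (t n)%:R%R : R).
  by move=> m n /eqP; rewrite eqr_nat => /eqP /tI.
have [V FV /splits_range [inV outV]] :=
  Fsplit _ (injective_range_infinite _ _ tRI).
exists U, V; split=> // b N.
(* [V] splits the ranks, not the terms. As the terms before [N] have ranks below some [B], a rank
   from [B] on can only come from a term of index at least [N]. *)
have bdd : exists B, forall n m, (n < N)%N -> rank G (u n) m -> (m < B)%N.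
  elim: N => [|N [B HB]]; first by exists 0%N.
  have [[m rm]|nr] := pselect (exists m, rank G (u N) m); last first.
    exists B => n m; rewrite ltnS leq_eqVlt => /orP[/eqP ->|]; last exact: HB.
    by move=> rm; case: nr; exists m.
  exists (maxn B m.+1) => n k; rewrite ltnS leq_eqVlt => /orP[/eqP ->|nN].
    by move=> /(rank_unique _ _ _ _ rm) <-; rewrite leq_max leqnn orbT.
  by move=> /(HB _ _ nN) kB; rewrite leq_max kB.
have [B HB] := bdd.
have : Defs.infinite_set [set n | `[< V (t n)%:R%R >] = b].
  case: b; first by apply: sub_infinite_set inV => n /= /asboolP.
  by apply: sub_infinite_set outV => n /= /asboolPn/negbTE.
move=> Vb; have : exists2 k, (B <= t k)%N & `[< V (t k)%:R%R >] = b.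
  apply: contrapT => nk; apply: Vb.
  apply: sub_finite_set (_ : finite_set (t @^-1` `I_B)).
    by move=> k kb /=; rewrite ltnNge; apply/negP => Bt; apply: nk; exists k.
  by apply: finite_preimage (finite_II B) => k k' _ _ /tI.
move=> [k Bk Vk]; have [n rn] : M (t k) by apply: tM; exists k.
exists n; last by exists (t k).
by rewrite leqNgt; apply/negP => nN; have := HB _ _ nN rn; rewrite ltnNge Bk.
Qed.

(** * Subspaces of the cube [2^I] *)

Definition cube_subspace {I : choiceType} (X : set (I -> bool)) : Type :=
  {x | X x}.

Section CubeSubspace.
Context {I : choiceType} {X : set (I -> bool)}.
Local Notation T := (cube_subspace X).
Implicit Types (x y : T) (s : seq (I * bool)).

HB.instance Definition _ := gen_eqMixin T.
HB.instance Definition _ := gen_choiceMixin T.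

(** Basic open sets are indexed by finite lists of constraints, so that coding lists later bounds
    the weight. *)
Definition box s : set T := [set x | forall c, c \in s -> sval x c.1 = c.2].

Let box_open (U : set T) := forall x, U x -> exists2 s, box s x & box s `<=` U.

Let box_openT : box_open setT.
Proof. by move=> x _; exists [::]. Qed.

Let box_openI U V : box_open U -> box_open V -> box_open (U `&` V).
Proof.
move=> Uo Vo x [/Uo [s sx sU] /Vo [t tx tV]]; exists (s ++ t).
  by move=> c; rewrite mem_cat => /orP[/sx|/tx].
by move=> y sty; split; [apply: sU|apply: tV] => c cs; apply: sty;
  rewrite mem_cat cs ?orbT.
Qed.

Let box_open_bigU (J : Type) (f : J -> set T) :
  (forall j, box_open (f j)) -> box_open (\bigcup_j f j).
Proof.
move=> fo x [j _ /fo [s sx sf]]; exists s => // y /sf fy.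
by exists j.
Qed.

HB.instance Definition _ := isOpenTopological.Build T
  box_openT box_openI box_open_bigU.

Lemma openP (U : set T) :
  open U <-> forall x, U x -> exists2 s, box s x & box s `<=` U.
Proof. by []. Qed.

Lemma open_box s : open (box s).
Proof. by apply/openP => x sx; exists s. Qed.

Lemma box_base : is_base (range box).
Proof.
split=> [_ [s _ <-]|U /openP Uo x /Uo [s sx sU]]; first exact: open_box.
by exists (box s).
Qed.

Lemma box1_nbhs x i : nbhs x [set y : T | sval y i = sval x i].
Proof.
apply: filterS (open_nbhs_nbhs (conj (open_box [:: (i, sval x i)]) _)).
  by move=> y /(_ (i, sval x i)); apply; rewrite inE.
by move=> c; rewrite inE => /eqP ->.
Qed.

Lemma cube_hausdorff : hausdorff_space T.
Proof.
move=> [x Xx] [y Xy] xy; apply/eq_exist/funext => i.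
have [z [/= zx zy]] := xy _ _ (box1_nbhs _ i) (box1_nbhs _ i).
by rewrite -zx -zy.
Qed.

Lemma cube_cvg (F : set_system T) {FF : Filter F} x :
  (forall i, F [set y : T | sval y i = sval x i]) -> F --> x.
Proof.
move=> Fx U; rewrite nbhsE => -[V [/openP Vo Vx] VU].
have [s sx sV] := Vo _ Vx; apply: filterS (subset_trans sV VU) _.
elim: s sx {sV} => [|c s IH] sx.
  by apply: filterS filterT => y _ c; rewrite in_nil.
have : F (box s) by apply: IH => d ds; apply: sx; rewrite inE ds orbT.
apply: filterS2 (Fx c.1) => y yc ys d; rewrite inE => /orP[/eqP ->|/ys //].
by rewrite yc sx // mem_head.
Qed.

(** The hypothesis is closedness of [X] in the product. An ultrafilter decides every coordinate, and
    the decided values form its limit. *)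
Lemma cube_compact :
  (forall p : I -> bool,
    (forall t : seq I, exists2 x, X x & forall i, i \in t -> x i = p i) -> X p) ->
  compact [set: T].
Proof.
move=> Xcl; rewrite compact_ultra => F FU _.
pose p i := `[< F [set y : T | sval y i] >].
have Fp i : F [set y : T | sval y i = p i].
  rewrite /p; case: asboolP => [|nF].
    by apply: filterS => y /= ->.
  have [//|] := in_ultra_setVsetC [set y : T | sval y i] FU.
  by apply: filterS => y /= /negP /negbTE ->.
have Xp : X p.
  apply: Xcl => t.
  have : F [set y : T | forall i, i \in t -> sval y i = p i].
    elim: t => [|i t IH]; first by apply: filterS filterT => y _ i; rewrite in_nil.
    apply: filterS2 (Fp i) IH => y yi yt j; rewrite inE => /orP[/eqP -> //|/yt //].
  by move=> /filter_ex [y yt]; exists (sval y) => //; exact: (svalP y).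
by exists (exist _ p Xp); split=> //; apply: cube_cvg => i; exact: Fp.
Qed.

End CubeSubspace.

(** An injective sequence has a cluster point, and an open singleton there would have to recur along
    the sequence. *)
Lemma infinite_compact_not_discrete (T : topologicalType) :
  Defs.infinite_set [set: T] -> compact [set: T] -> ~ discrete_top T.
Proof.
move=> /infinite_inj [s sI _] cT dT.
have [x [_ xcl]] := cT (s @ \oo) _ (filterT : (s @ \oo) [set: T]).
have nx : nbhs x [set x] by apply: open_nbhs_nbhs; split=> //; exact: dT.
have [N sN] : exists N, forall n, (N <= n)%N -> s n <> x.
  have [[N sN]|nN] := pselect (exists N, s N = x); last first.
    by exists 0%N => n _ sn; apply: nN; exists n.
  by exists N.+1 => n Nn; rewrite -sN => /sI nN; move: Nn; rewrite nN ltnn.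
have Fs : (s @ \oo) [set s n | n in [set n | (N <= n)%N]].
  by exists N => // n Nn /=; exists n.
by have [_ [[n /sN sn <-] /= snx]] := xcl _ _ Fs nx.
Qed.

(** * The space of solutions of the level constraints *)

Section Solutions.
Context {K L : choiceType} {lt : L -> L -> Prop} {l0 : L}.
Hypothesis lt_wf : well_founded lt.
Hypothesis lt_l0 : forall l, ~ lt l l0.
Context {r : K -> nat -> K * L} {G : K -> set (nat -> bool)}
  {V : K -> nat -> bool}.

(** Masking the other coordinates by [false] makes the point depend on levels below [l] only, as the
    recursion requires. *)
Definition below (e : nat -> K * L) (l : L) (x : K * L -> bool) : nat -> bool :=
  fun n => `[< lt (e n).2 l >] && x (e n).

(* Coordinate [(k, l)] is tied only to coordinates of level below [l], and the
   bottom level [l0] is free. The closures of [{rank in V k}] and of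
   [{rank not in V k}], which may touch at the boundary of [G k], are pulled
   apart by this coordinate. *)
Definition solutions : set (K * L -> bool) := [set x | forall k l m, l <> l0 ->
  rank (G k) (below (r k) l x) m -> x (k, l) = V k m].

(** Having rank [m] depends on the first [m] digits only, so each constraint involves finitely many
    coordinates. *)
Lemma solutions_closed (p : K * L -> bool) :
  (forall t : seq (K * L),
    exists2 x, solutions x & forall i, i \in t -> x i = p i) ->
  solutions p.
Proof.
move=> pt k l m ll0 rp.
have [x Xx xp] := pt ((k, l) :: [seq r k i | i <- iota 0 m]).
rewrite -xp ?mem_head //; apply: Xx => //; apply: rank_cylinder rp => i im.
by rewrite /below xp // inE; apply/orP; right; rewrite map_f // mem_iota.
Qed.

(** Well-founded recursion on levels: lower levels determine the rank, hence the forced value. Where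
    there is no rank the value is [false]. *)
Lemma solutions_extend (a : K -> bool) :
  exists2 x, solutions x & forall k, x (k, l0) = a k.
Proof.
pose mask l (rec : forall l', lt l' l -> K -> bool) k n : bool :=
  if pselect (lt (r k n).2 l) is left h then rec _ h (r k n).1 else false.
pose step l (rec : forall l', lt l' l -> K -> bool) k : bool :=
  if `[< l = l0 >] then a k
  else `[< exists2 m, rank (G k) (mask l rec k) m & V k m >].
pose x i := Fix lt_wf _ step i.2 i.1.
have xE k l : x (k, l) = step l (fun l' _ k' => x (k', l')) k.
  rewrite /x /= Fix_eq // => l' f f' ff'; congr step.
  by apply/functional_extensionality_dep => z; apply/funext => h; exact: ff'.
exists x => [k l m ll0|k]; last by rewrite xE /step; case: asboolP.
rewrite xE /step; case: asboolP => // _.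
have <- : below (r k) l x = mask l (fun l' _ k' => x (k', l')) k.
  apply/funext => n; rewrite /below /mask; case: pselect => h.
    by rewrite asboolT //; case: (r k n).
  by rewrite asboolF.
move=> rm; case: asboolP => [[m' /(rank_unique _ _ _ _ rm) <- ->] //|nV].
by case VE : (V k m) => //; case: nV; exists m.
Qed.

Local Notation T := (cube_subspace solutions).

Lemma solutions_infinite : Defs.infinite_set [set: K] ->
  Defs.infinite_set [set: T].
Proof.
move=> /infinite_inj [s sI _].
have /choice [u uE] n : exists x : T, forall k, sval x (k, l0) = (k == s n).
  by have [x Xx xa] := solutions_extend (fun k => k == s n); exists (exist _ x Xx).
have uI : injective u.
  move=> m n umn; apply: sI; apply/eqP.
  by rewrite -uE -umn uE.
exact: sub_infinite_set (injective_range_infinite _ _ uI).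
Qed.

Lemma solutions_no_convergent (R : realType) (F : set (set R)) :
  splitting_open_family F ->
  (forall s : nat -> L, exists l, forall n, lt (s n) l) ->
  (forall e : nat -> K * L, exists2 d : nat -> K * L, range e `<=` range d &
    forall U W, F U -> F W -> exists k, [/\ r k = d,
      G k = cantor_embedding R @^-1` U & V k = fun m => `[< W m%:R%R >]]) ->
  ~ has_nontrivial_convergent_seq T.
Proof.
move=> Fspl bound code [u [x [uI ux]]].
have ev i : exists N, forall n, (N <= n)%N -> sval (u n) i = sval x i.
  by have [N _ uN] := ux _ (box1_nbhs x i); exists N => n Nn; exact: uN.
have sep m n : m <> n -> exists i, sval (u m) i <> sval (u n) i.
  move=> mn; apply: contrapT => nw; apply/mn/uI/eq_sig_hprop => [y|].
    exact: Prop_irrelevance.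
  by apply/funext => i; apply: contrapT => ui; apply: nw; exists i.
have [i0 _] := sep 0%N 1%N (fun e => ltac:(discriminate e)).
have /choice [w wP] : forall mn : nat * nat, exists i,
    mn.1 <> mn.2 -> sval (u mn.1) i <> sval (u mn.2) i.
  move=> [m n]; have [|mn] := pselect (m <> n); last by exists i0 => /mn.
  by move=> /sep [i ui]; exists i.
have [d dw code_d] := code (fun n => w (odflt (0, 0)%N (unpickle n))).
have {}dw m n : exists j, d j = w (m, n).
  have [|j _ dj] := dw (w (m, n)); first by exists (pickle (m, n)); rewrite ?pickleK.
  by exists j.
(* All coordinates listed by [d] lie below [l], so masking erases none of them and [v] stays
   injective. *)
have [l dl] := bound (fun n => (d n).2).
have ll0 : l <> l0 by move=> le; apply: (lt_l0 (d 0%N).2); rewrite -le.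
pose v n := below d l (sval (u n)).
have vI : injective v.
  move=> m n vmn; apply: contrapT => mn; have [j dj] := dw m n.
  apply: (wP (m, n) mn); rewrite /= -dj.
  by have := congr1 (@^~ j) vmn; rewrite /v /below asboolT.
have vx m : exists N, forall n, (N <= n)%N ->
    cylinder (below d l (sval x)) m (v n).
  elim: m => [|m [N IH]]; first by exists 0%N.
  have [N' uN'] := ev (d m); exists (maxn N N') => n.
  rewrite geq_max => /andP[/IH vn /uN' un] i.
  by rewrite ltnS leq_eqVlt => /orP[/eqP ->|/vn //]; rewrite /v /below un.
have [U [W [FU FW UW]]] := splitting_ranks _ _ _ _ Fspl vI vx.
have [k [rk Gk Vk]] := code_d U W FU FW.
(* Coordinate [(k, l)] is eventually constant along [u], yet some later term is forced to the
   opposite value. *)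
have [N uN] := ev (k, l).
have [n /uN un [m rm Wm]] := UW (~~ sval x (k, l)) N.
have := svalP (u n) k l m ll0; rewrite rk Gk Vk un Wm => /(_ rm).
by case: (sval x _).
Qed.
End Solutions.

(** * Uncountability of kappa and assembly of the space *)

(** A set [U] never splits an intersection with [U] itself, so a second member is required. *)
Lemma splitting_family_not_subsingleton (R : realType) (F : set (set R))
    (T : Type) (t : T) :
  splitting_open_family F -> ~ (F #<= [set t]).
Proof.
move=> [_ Fspl] /pcard_surjP [g gF].
have Fg U : F U -> U = g t by move=> /gF [_ -> <-].
have natI : injective (fun n => n%:R%R : R).
  by move=> m n /eqP; rewrite eqr_nat => /eqP.
have [U FU [U1 _]] := Fspl _ (injective_range_infinite _ _ natI).
have [W FW [_]] := Fspl _ U1; apply.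
rewrite (Fg _ FU) (Fg _ FW); apply: sub_finite_set (finite_set0 R).
by move=> y [[]].
Qed.

Lemma cofinal_countable_pullback (I K : Type) (j : I -> K) (C : set (set K)) :
  injective j -> cofinal_countable_family C ->
  cofinal_countable_family [set j @^-1` D | D in C].
Proof.
move=> jI [Ccount Ccof]; split=> [_ [D /Ccount Dc <-]|A Ac].
  have jD : j @` (j @^-1` D) `<=` D by move=> _ [i Di <-].
  have jE : j @` (j @^-1` D) #= j @^-1` D by apply: inj_card_eq => x y _ _ /jI.
  rewrite /countable -(card_le_eql jE).
  exact: sub_countable (subset_card_le jD) Dc.
have [|D CD jAD] := Ccof (j @` A).
  exact: sub_countable (card_image_le _ _) Ac.
by exists (j @^-1` D); [exists D|move=> i Ai; apply: jAD; exists i].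
Qed.

Theorem theorem2p9 (R : realType) (K : Type) :
  (* s(R) <= kappa *)
  (exists F : set (set R), splitting_open_family F /\ F #<= [set: K]) ->
  (* kappa = cof([kappa]^{aleph_0}, ⊆) *)
  ((exists C : set (set K), cofinal_countable_family C /\ C #<= [set: K]) /\
   (forall C : set (set K), cofinal_countable_family C -> [set: K] #<= C)) ->
  (* z <= kappa *)
  exists T : topologicalType,
    [/\ hausdorff_space T, infinite_set [set: T], compact [set: T],
        non_sequential T &
        exists B : set (set T), is_base B /\ B #<= [set: K]].
Proof.
move=> [F [Fspl FK]] [[C [Ccof CK]] Kmin].
have Kunc : ~ countable [set: K].
  (* If [K] were countable, the single set [K] would be cofinal, forcing kappa, and with it [F], to
     have at most one element. *)
  move=> Kc; apply: (splitting_family_not_subsingleton _ _ _ [set: K] Fspl).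
  apply: card_le_trans FK (Kmin _ _); split=> [_ -> //|A _].
  by exists setT.
have Kinf : Defs.infinite_set [set: K] by move=> /finite_set_countable.
elim/Ppointed: K => K in C Ccof CK FK Kunc Kinf Kmin *.
  by case: Kinf; rewrite emptyE.
have [p pI] := cofinal_countable_square Kinf Ccof CK.
have [L [lt [j [l0 [lt_wf jI lt_l0 bound]]]]] := uncountable_levels K Kunc.
have iI : injective (fun i : K * L => p (i.1, j i.2)).
  by move=> [k l] [k' l'] /pI [-> /jI ->].
have [C'count C'cof] := cofinal_countable_pullback _ _ _ _ iI Ccof.
have {CK}C'K : [set (fun i => p (i.1, j i.2)) @^-1` D | D in C] #<= [set: K].
  exact: card_le_trans (card_image_le _ _) CK.
have /pcard_surjP [sC sCP] := C'K.
have /pcard_surjP [sF sFP] := FK.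
have /choice [en enP] : forall D : set (K * L), exists e : nat -> K * L,
    countable D -> D `<=` range e.
  move=> D; have [/countable_injP [f fI]|nD] := pselect (countable D); last first.
    by exists (fun=> (point, l0)) => /nD.
  exists (fun n => xget (point, l0) [set i | D i /\ f i = n]) => _ i Di.
  exists (f i) => //; have [] := @xgetPex _ (point, l0) [set i' | D i' /\ f i' = f i].
    by exists i.
  by move=> Dx fx; apply: fI fx; exact: mem_set.
(* An index codes a countable set and two open sets. Other indices get empty sets, where no rank
   exists and nothing is constrained. *)
have /choice [q qP] : forall k, exists t : set (K * L) * (set R * set R),
    forall a b c, k = p (a, p (b, c)) -> t = (sC a, (sF b, sF c)).
  move=> k; have [[a [b [c ->]]]|nk] :=
    pselect (exists a b c, k = p (a, p (b, c))); last first.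
    by exists (set0, (set0, set0)) => a b c ke; case: nk; exists a, b, c.
  by exists (sC a, (sF b, sF c)) => a' b' c' /pI [-> /pI [-> ->]].
pose r k := en (q k).1.
pose G k := cantor_embedding R @^-1` (q k).2.1.
pose V k (m : nat) := `[< (q k).2.2 m%:R%R >].
pose X := @solutions K L lt l0 r G V.
have compX : compact [set: cube_subspace X].
  exact/cube_compact/solutions_closed.
have infX : Defs.infinite_set [set: cube_subspace X].
  exact: solutions_infinite.
exists (cube_subspace X); split=> //.
- exact: cube_hausdorff.
- split; first exact: infinite_compact_not_discrete.
  apply: (solutions_no_convergent lt_l0 _ _ Fspl bound) => e.
  have [|D C'D eD] := C'cof (range e).
    exact: sub_countable (card_image_le _ _) (countableP _).
  exists (en D); first exact: subset_trans eD (enP _ (C'count _ C'D)).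
  have [a _ aD] := sCP _ C'D.
  move=> U W /sFP [b _ bU] /sFP [c _ cW]; exists (p (a, p (b, c))).
  by rewrite /r /G /V (qP _ a b c erefl) aD bU cW.
- exists (range box); split; first exact: box_base.
  apply: card_le_trans (card_image_le _ _) _.
  have [t tI _] := infinite_inj _ _ Kinf.
  have [f fI] := seq_inj _ _ Kinf pI.
  (* The boolean is coded by one of the two distinct points [t 0] and [t 1]. *)
  pose code (c : K * L * bool) := p (p (c.1.1, j c.1.2), t c.2).
  apply/pcard_injP; exists (fun s => f (map code s)).
  move=> s s' _ _ /fI; apply: inj_map => -[[k l] b] [[k' l'] b'] /pI.
  by move=> [/pI [-> /jI ->] /tI]; case: b; case: b'.
Qed.
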